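(* Let $\mathcal{F}=\{f_{n}\}_{n\in\mathbb{N}}$ be a time varying map on a compact metric space $(X,d)$ and let $Y$ be a closed subset of $X$. Then the following statements hold: (a) If there is an open set $U\subseteq X$ such that $Y\subseteq U$ and $\mathcal{F}$ has the h-shadowing property on $U$, then $\mathcal{F}$ has the s-limit shadowing property on $Y$. If in addition $Y\subseteq f_{n}(Y)$ for every $n\in\mathbb{N}$, then $\mathcal{F}$ has the limit shadowing property on $Y$. (b) If $Y$ is invariant and $\mathcal{F}|_{Y}$ has the h-shadowing property, then $\mathcal{F}|_{Y}$ has the s-limit shadowing property and the limit shadowing property. (c) If $\mathcal{F}$ has the h-shadowing property, then $\mathcal{F}$ has the s-limit shadowing property. If in addition all the maps $f_n$ are surjective, then $\mathcal{F}$ has the limit shadowing property.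
   Context: $\mathbb{N}=\{1,2,3,\dots\}$. A time varying map on a metric space $(X,d)$ is a sequence $\mathcal{F}=\{f_n\}_{n\in\mathbb{N}}$ of continuous maps $f_n:X\to X$. Put $\mathcal{F}_n:=f_n\circ f_{n-1}\circ\cdots\circ f_1$ for $n\ge 1$ and $\mathcal{F}_0:=\mathrm{Id}_X$. A subset $Y\subseteq X$ is invariant under $\mathcal{F}$ if $f_n(Y)=Y$ for all $n\ge1$; in that case $\mathcal{F}|_Y:=\{f_n|_Y\}_{n\in\mathbb{N}}$, a time varying map on the metric space $(Y,d)$. For $\delta>0$, a sequence $\{x_n\}_{n\ge 0}$ in $X$ is a $\delta$-pseudo orbit of $\mathcal{F}$ if $d(f_{n+1}(x_n),x_{n+1})<\delta$ for all $n\ge 0$; a finite sequence $\{x_0,\dots,x_m\}$ is a finite $\delta$-pseudo orbit if $d(f_{n+1}(x_n),x_{n+1})<\delta$ for all $0\le n<m$. A sequence $\{x_n\}_{n\ge0}$ is a limit pseudo orbit if $d(f_{n+1}(x_n),x_{n+1})\to 0$ as $n\to+\infty$. Let $Z\subseteq X$. h-shadowing property on $Z$: for every $\varepsilon>0$ there is $\delta>0$ such that for every finite $\delta$-pseudo orbit $\{x_0,\dots,x_m\}$ contained in $Z$ there is $x\in X$ with $d(\mathcal{F}_n(x),x_n)<\varepsilon$ for every $0\le n<m$ and $\mathcal{F}_m(x)=x_m$. Limit shadowing property on $Z$: for every limit pseudo orbit $\{x_n\}_{n\ge0}$ contained in $Z$ there is $x\in X$ with $d(\mathcal{F}_n(x),x_n)\to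 0$ as $n\to+\infty$. s-limit shadowing property on $Z$: for every $\varepsilon>0$ there is $\delta>0$ such that (1) for every $\delta$-pseudo orbit $\{x_n\}_{n\ge0}$ contained in $Z$ there exists $x\in X$ with $d(\mathcal{F}_n(x),x_n)<\varepsilon$ for all $n\ge 0$, and (2) if in addition $\{x_n\}_{n\ge0}$ is a limit pseudo orbit, then (this $x$ can be taken so that) $d(\mathcal{F}_n(x),x_n)\to0$ as $n\to+\infty$. When $Z$ is the whole space the words ''on $Z$'' are omitted. *)

(* Defs.v *)
From HB Require Import structures.
From mathcomp Require Import all_boot all_order all_algebra.
From mathcomp Require Import all_classical all_reals all_analysis.

Set Implicit Arguments.
Unset Strict Implicit.
Unset Printing Implicit Defensive.

Import Order.TTheory GRing.Theory Num.Theory.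
Import numFieldNormedType.Exports.
Import metricType_numDomainType.

Local Open Scope classical_set_scope.
Local Open Scope ring_scope.

(* A time varying map {f_n}, n = 1, 2, 3, ..., is indexed from 0 here:
   [F n] stands for f_(n+1). *)
Record tvmap (R : realType) (X : metricType R) := TVMap {
  tv_fun :> nat -> X -> X;
  tv_continuous : forall n, continuous (tv_fun n)
}.

Section Shadowing.
Context {R : realType} {X : metricType R} (F : tvmap X).

(* tv_iter n = f_n \o ... \o f_1, with tv_iter 0 the identity. *)
Fixpoint tv_iter (n : nat) (x : X) : X :=
  if n is k.+1 then F k (tv_iter k x) else x.

Definition tv_invariant (Y : set X) : Prop := forall n, F n @` Y = Y.

Definition pseudo_orbit (delta : R) (xs : nat -> X) : Prop :=
  forall n, mdist (F n (xs n)) (xs n.+1) < delta.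

(* A finite sequence x_0, ..., x_m is given by [xs : nat -> X], of which only
   the values at 0, ..., m matter. *)
Definition finite_pseudo_orbit (delta : R) (m : nat) (xs : nat -> X) : Prop :=
  forall n, (n < m)%N -> mdist (F n (xs n)) (xs n.+1) < delta.

Definition limit_pseudo_orbit (xs : nat -> X) : Prop :=
  (fun n => mdist (F n (xs n)) (xs n.+1)) @ \oo --> (0 : R).

Definition shadows (eps : R) (x : X) (xs : nat -> X) : Prop :=
  forall n, mdist (tv_iter n x) (xs n) < eps.

Definition limit_shadows (x : X) (xs : nat -> X) : Prop :=
  (fun n => mdist (tv_iter n x) (xs n)) @ \oo --> (0 : R).

Definition h_shadowing_on (Z : set X) : Prop :=
  forall eps : R, 0 < eps -> exists2 delta : R, 0 < delta &
    forall (m : nat) (xs : nat -> X),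
      (forall n, (n <= m)%N -> Z (xs n)) ->
      finite_pseudo_orbit delta m xs ->
      exists x : X,
        (forall n, (n < m)%N -> mdist (tv_iter n x) (xs n) < eps) /\
        tv_iter m x = xs m.

Definition limit_shadowing_on (Z : set X) : Prop :=
  forall xs : nat -> X, (forall n, Z (xs n)) -> limit_pseudo_orbit xs ->
    exists x : X, limit_shadows x xs.

Definition s_limit_shadowing_on (Z : set X) : Prop :=
  forall eps : R, 0 < eps -> exists2 delta : R, 0 < delta &
    forall xs : nat -> X, (forall n, Z (xs n)) -> pseudo_orbit delta xs ->
      (exists x : X, shadows eps x xs) /\
      (limit_pseudo_orbit xs ->
         exists x : X, shadows eps x xs /\ limit_shadows x xs).

Definition h_shadowing : Prop := h_shadowing_on [set: X].
Definition limit_shadowing : Prop := limit_shadowing_on [set: X].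
Definition s_limit_shadowing : Prop := s_limit_shadowing_on [set: X].

End Shadowing.

(* The metric space (Y, d).  The library puts only the initial topology on
   [set_type Y], so the induced metric is put on an alias. *)
Definition submetric (R : realType) (X : metricType R) (Y : set X) : Type :=
  set_type Y.

Section Submetric.
Context {R : realType} {X : metricType R} (Y : set X).

HB.instance Definition _ := Choice.on (submetric Y).

Definition submetric_val (y : submetric Y) : X := \val (y : set_type Y).

Definition submetric_dist (y z : submetric Y) : R :=
  mdist (submetric_val y) (submetric_val z).

Let distxx y : submetric_dist y y = 0.
Proof. exact: mdistxx. Qed.

Let dist_positivity y z : submetric_dist y z = 0 -> y = z.
Proof. by move=> /mdist_positivity yz; exact: val_inj. Qed.

Let dist_sym y z : submetric_dist y z = submetric_dist z y.
Proof. exact: metric_sym. Qed.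

Let dist_triangle z y t :
  submetric_dist y t <= submetric_dist y z + submetric_dist z t.
Proof. exact: metric_triangle. Qed.

HB.instance Definition _ := @isMetric.Build R (submetric Y) submetric_dist
  distxx dist_positivity dist_sym dist_triangle.

Lemma submetric_mdistE (y z : submetric Y) :
  mdist y z = mdist (submetric_val y) (submetric_val z).
Proof. by []. Qed.

End Submetric.

Section Restriction.
Context {R : realType} {X : metricType R} (F : tvmap X) (Y : set X)
  (invY : tv_invariant F Y).

Lemma restr_subproof n (y : submetric Y) : F n (submetric_val y) \in Y.
Proof.
have : (F n @` Y) (F n (submetric_val y)).
  by exists (submetric_val y) => //; exact/set_mem/(valP (y : set_type Y)).
by rewrite (invY n) => /mem_set.
Qed.

Definition restr_fun (n : nat) (y : submetric Y) : submetric Y :=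
  exist (fun x => x \in Y) (F n (submetric_val y)) (restr_subproof n y).

Lemma restr_continuous n : continuous (restr_fun n).
Proof.
move=> y A /nbhs_mdistP[e /= e0 eA].
have nB : nbhs (F n (submetric_val y))
    [set x | mdist (F n (submetric_val y)) x < e].
  by rewrite -nbhs_nbhs_mdist; exists e.
have /nbhs_mdistP[d /= d0 dB] := @tv_continuous _ _ F n (submetric_val y) _ nB.
by rewrite nbhs_simpl /= -nbhs_nbhs_mdist; exists d => //= z /= yz; apply: eA; exact: dB.
Qed.

Definition restr : tvmap (submetric Y) := TVMap restr_continuous.

End Restriction.

(* Main.v *)
Require Import Defs.
From mathcomp Require Import all_boot all_order all_algebra.
From mathcomp Require Import all_classical all_reals all_analysis.
From mathcomp Require Import lra zify.

Import Order.TTheory GRing.Theory Num.Theory.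
Import numFieldNormedType.Exports.

Local Open Scope classical_set_scope.
Local Open Scope ring_scope.

(* Given a limit pseudo orbit (x_n) in Y, let k_i be a time after which its jumps
   are below the h-shadowing modulus d_i of e / 2^(i+1).  Shadow x_0, ..., x_(k_1)
   by an orbit hitting x_(k_1) exactly, follow that orbit up to time k_1 and
   (x_n) afterwards, shadow the result up to time k_2, and so on.  The errors sum
   to e / 2^j for the times after k_j, and a cluster point of the initial points
   shadows and limit shadows (x_n).  When Y is contained in every f_n(Y), a limit
   pseudo orbit can be changed at finitely many times, by pulling back one of its
   points, so that all its jumps are small; this turns s-limit shadowing into
   limit shadowing. *)

Lemma cvg0_eventually_lt (R : realType) (u : nat -> R) (u0 : forall n, 0 <= u n) :
  u @ \oo --> (0 : R) <->
  forall e, 0 < e -> exists N, forall n, (N <= n)%N -> u n < e.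
Proof.
split=> [/cvgrPdist_lt uP e /uP [N _ NP]|uP].
  by exists N => n /NP /=; rewrite sub0r normrN ger0_norm.
apply/cvgrPdist_lt => e /uP [N NP]; exists N => // n /NP.
by rewrite /= sub0r normrN ger0_norm.
Qed.

Section Metric.
Set Implicit Arguments.
Unset Strict Implicit.
Context {R : realType} {X : metricType R}.
Implicit Types (Y U : set X) (x y : X).

Lemma mdist_nbhs x (e : R) : 0 < e -> nbhs x [set y | mdist x y < e].
Proof. by move=> e0; apply/metricType_numDomainType.nbhs_mdistP; exists e. Qed.

(** A ball of radius e around x inside U contains the balls of radius e / 2 around all points within
    e / 2 of x; compactness of Y makes the radius uniform. *)
Lemma compact_thickening_subset Y U : compact Y -> open U -> Y `<=` U ->
  exists2 e : R, 0 < e & forall x y, Y x -> mdist x y < e -> U y.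
Proof.
move=> /compact_near_coveringP cY oU YU.
have [|e /= e0 eP] :=
    cY _ (0 : R)^'+ (fun e x => forall y, mdist x y < e -> U y) _.
  move=> x Yx.
  have /metricType_numDomainType.nbhs_mdistP[e /= e0 eU] : nbhs x U.
    by apply: open_nbhs_nbhs; split=> //; exact: YU.
  have e20 : 0 < e / 2 by lra.
  exists ([set y | mdist x y < e / 2], [set r : R | r < e / 2]) => /=.
    by split; [exact: mdist_nbhs | exact: nbhs_right_lt].
  move=> [y r] /= [xy re] z yz; apply: eU => /=.
  by have := metric_triangle x y z; lra.
have e20 : 0 < e / 2 by lra.
exists (e / 2) => // x y Yx xy; apply: (eP (e / 2) _ e20 x Yx y xy).
by rewrite /= sub0r normrN ger0_norm; lra.
Qed.

Lemma submetric_valP Y (y : submetric Y) : Y (submetric_val y).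
Proof. exact: set_mem (valP (y : set_type Y)). Qed.

(** A filter on [submetric Y] is pushed forward to X, where it clusters at a point of Y; since the
    distances agree, the original filter clusters there too. *)
Lemma submetric_compact Y : compact Y -> compact [set: submetric Y].
Proof.
move=> cY G PG GT.
have GY : (@submetric_val _ _ Y @ G) Y.
  apply: (filterS (F := G)) GT => y _; exact: submetric_valP.
have [x [Yx clx]] := cY _ (fmap_proper_filter _ PG) GY.
pose y : submetric Y := exist (fun x => x \in Y) x (mem_set Yx).
exists y; split=> // A B GA /metricType_numDomainType.nbhs_mdistP[e /= e0 eB].
have [|_ [[z Az <-] xz]] := clx (@submetric_val _ _ Y @` A) _ _ (mdist_nbhs x e0).
  by apply: (filterS (F := G)) GA => z Az; exists z.
by exists z; split=> //; exact: eB.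
Qed.

End Metric.

Section Shadowing.
Set Implicit Arguments.
Unset Strict Implicit.
Context {R : realType} {X : metricType R} (F : tvmap X).
Implicit Types (xs : nat -> X) (Y U : set X).

Lemma limit_pseudo_orbitP xs : limit_pseudo_orbit F xs <->
  forall e, 0 < e ->
    exists N, forall n, (N <= n)%N -> mdist (F n (xs n)) (xs n.+1) < e.
Proof. by apply: cvg0_eventually_lt => n; exact: mdist_ge0. Qed.

Lemma limit_shadowsP x xs : limit_shadows F x xs <->
  forall e, 0 < e ->
    exists N, forall n, (N <= n)%N -> mdist (tv_iter F n x) (xs n) < e.
Proof. by apply: cvg0_eventually_lt => n; exact: mdist_ge0. Qed.

Lemma tv_iter_continuous n : continuous (tv_iter F n).
Proof.
elim: n => [|n IHn] x; first exact: cvg_id.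
exact: (cvg_comp (tv_iter F n) (F n) (IHn x) (@tv_continuous _ _ F n _)).
Qed.

(** Take x to be a cluster point of z. Each [tv_iter F n] is continuous, so a non-strict bound that
    holds eventually along z passes to x, with N free to depend on n and c. *)
Lemma shadowing_cluster (xs z : nat -> X) : compact [set: X] ->
  exists x, forall n (c : R),
    (exists N, forall i, (N <= i)%N -> mdist (tv_iter F n (z i)) (xs n) <= c) ->
    mdist (tv_iter F n x) (xs n) <= c.
Proof.
move=> cX; have [x [_ clx]] := cX (z @ \oo) _ filterT.
exists x => n c [N NP]; apply/ler_addgt0Pr => e e0.
have [|_ [[i /NP ic <-] xi]] := clx (z @` [set i | (N <= i)%N]) _ _
    (@tv_iter_continuous n x _ (mdist_nbhs (tv_iter F n x) e0)).
  by exists N => // i /= Ni; exists i.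
have := metric_triangle (tv_iter F n x) (tv_iter F n (z i)) (xs n).
by move: xi; rewrite /=; lra.
Qed.

Section Approximation.
Variables (U : set X) (xs : nat -> X) (e : R) (d : nat -> R) (k : nat -> nat).
Hypothesis e0 : 0 < e.
Hypothesis dP : forall i m ys, (forall n, (n <= m)%N -> U (ys n)) ->
  finite_pseudo_orbit F (d i) m ys ->
  exists x, (forall n, (n < m)%N -> mdist (tv_iter F n x) (ys n) < e / 2 ^+ i.+1) /\
            tv_iter F m x = ys m.
Hypothesis d0 : forall i, 0 < d i.
Hypothesis thickU : forall n y, mdist (xs n) y < e -> U y.
Hypothesis k0 : k 0 = 0%N.
Hypothesis kS : forall i, (k i < k i.+1)%N.
Hypothesis kP : forall i n, (k i <= n)%N -> mdist (F n (xs n)) (xs n.+1) < d i.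

(* The shadowing of x_0, ..., x_(k_i) is refined by h-shadowing the pseudo
   orbit that follows z up to time k_i and xs afterwards: because z hits
   x_(k_i) exactly, its jumps are the late, smaller ones of xs only. *)
Lemma h_shadowing_approximation i : exists z,
  tv_iter F (k i) z = xs (k i) /\
  forall j n, (k j <= n < k i)%N ->
    mdist (tv_iter F n z) (xs n) < e * (2 ^- j - 2 ^- i).
Proof.
elim: i => [|i [z [zk zP]]].
  by exists (xs 0%N); rewrite k0; split=> // j n; rewrite ltn0 andbF.
have p0 j : 0 < (2 : R) ^- j by rewrite invr_gt0 exprn_gt0.
have pS j : (2 : R) ^- j = 2 * 2 ^- j.+1.
  by rewrite exprS invfM mulrA divff ?mul1r.
pose ys n := if (n < k i)%N then tv_iter F n z else xs n.
have [n _||z' [z'P z'k]] := @dP i (k i.+1) ys.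
- rewrite /ys; case: ltnP => [nk|_]; apply: (@thickU n); last by rewrite mdistxx.
  (* The case j = 0 bounds the error by e * (1 - 2^-i) < e, which keeps [ys] in U. *)
  have := zP 0%N n; rewrite k0 nk => /(_ isT); rewrite metric_sym expr0 invr1.
  by have := mulr_gt0 e0 (p0 i); lra.
- move=> n _; rewrite /ys; case: (ltnP n (k i)) => nk; last first.
    by rewrite ltnNge (leqW nk); exact: kP.
  case: ltnP => [_|nk']; first by rewrite mdistxx.
  (* The junction of the two pieces: the jump vanishes because z hits x_(k_i). *)
  have nki : n.+1 = k i by lia.
  by rewrite -[F n _]/(tv_iter F n.+1 z) nki zk mdistxx.
exists z'; split; first by rewrite z'k /ys ltnNge (ltnW (kS i)).
move=> j n /andP[jn nk]; have := z'P n nk; rewrite /ys.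
case: (ltnP n (k i)) => nki z'n.
  have := zP j n; rewrite jn nki => /(_ isT).
  have := metric_triangle (tv_iter F n z') (tv_iter F n z) (xs n).
  by rewrite (pS i); lra.
(* Here [ys] is [xs], and the new error e / 2^(i+1) is e * (2^-i - 2^-(i+1)), so j <= i suffices. *)
have ji : (j <= i)%N.
  rewrite leqNgt; apply/negP => ij.
  have : (k i.+1 <= k j)%N by apply: (homo_leq leqnn leq_trans) => // l; exact: ltnW.
  lia.
have : e * 2 ^- i <= e * 2 ^- j.
  by rewrite ler_pM2l// lef_pV2 ?posrE ?exprn_gt0// ler_weXn2l ?ler1n.
by rewrite (pS i); lra.
Qed.

End Approximation.

Lemma h_shadowing_s_limit Y U : compact [set: X] -> closed Y -> open U ->
  Y `<=` U -> h_shadowing_on F U -> s_limit_shadowing_on F Y.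
Proof.
move=> cX clY oU YU hU eps eps0.
have cY := subclosed_compact clY cX (@subsetT _ Y).
have [r r0 rU] := compact_thickening_subset cY oU YU.
(* Passing to a cluster point loses strictness, hence e < eps; e <= r keeps the e-neighbourhood of Y
   inside U. *)
pose e := Num.min (eps / 2) r.
have e0 : 0 < e by rewrite lt_min r0 andbT; lra.
have eeps : e < eps by rewrite gt_min; apply/orP; left; lra.
have er : e <= r by rewrite ge_min lexx orbT.
have p0 i : 0 < e / 2 ^+ i.+1 by rewrite divr_gt0 ?exprn_gt0.
pose d i := s2val (cid2 (hU _ (p0 i))).
have d0 i : 0 < d i := s2valP (cid2 (hU _ (p0 i))).
have dP i := s2valP' (cid2 (hU _ (p0 i))).
exists (d 0%N) => // xs Yxs pxs; split.
  have appr m : exists z, forall n, (n < m)%N -> mdist (tv_iter F n z) (xs n) < e.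
    have [n _|n _|z [zP _]] := dP 0%N m xs; [exact/YU/Yxs | exact: pxs |].
    by exists z => n /zP; rewrite expr1; lra.
  have [x xP] := shadowing_cluster xs (fun m => sval (cid (appr m))) cX.
  exists x => n; apply: le_lt_trans eeps; apply: xP.
  by exists n.+1 => m nm; apply/ltW/(svalP (cid (appr m))).
move=> /limit_pseudo_orbitP lxs.
pose N i := sval (cid (lxs _ (d0 i))).
(* Starting at 0 is allowed because all jumps are below [d 0], the chosen modulus. *)
pose k := fix k i := if i is j.+1 then maxn (k j).+1 (N j.+1) else 0%N.
have kS i : (k i < k i.+1)%N by rewrite /= leq_max leqnn.
have kP i n : (k i <= n)%N -> mdist (F n (xs n)) (xs n.+1) < d i.
  case: i => [_|i] //=; rewrite geq_max => /andP[_].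
  exact: (svalP (cid (lxs _ (d0 i.+1)))).
have thickU n y : mdist (xs n) y < e -> U y.
  by move=> xy; apply: (rU (xs n)) => //; exact: lt_le_trans er.
have appr := @h_shadowing_approximation U xs e d k e0 dP d0 thickU erefl kS kP.
have [x xP] := shadowing_cluster xs (fun i => sval (cid (appr i))) cX.
have xkP j n : (k j <= n)%N -> mdist (tv_iter F n x) (xs n) <= e / 2 ^+ j.
  (* Once i > n, also n < k i, and the i-th approximation has error below e * (2^-j - 2^-i) <= e /
     2^j. *)
  move=> jn; apply: xP; exists n.+1 => i ni.
  have ki : (i <= k i)%N by elim: i {ni} => // i IHi; exact: leq_ltn_trans (kS i).
  have [_ /(_ j n)] := svalP (cid (appr i)).
  rewrite jn (leq_trans ni ki) => /(_ isT) /ltW /le_trans; apply.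
  by rewrite ler_pM2l// gerBl invr_ge0 exprn_ge0.
exists x; split=> [n|].
  by apply: le_lt_trans eeps; have := xkP 0%N n; rewrite expr0 divr1; exact.
apply/limit_shadowsP => a a0.
have a'0 : 0 < a / e by exact: divr_gt0.
have [j _ /(_ j (leqnn j)) /= jP] := near_infty_natSinv_expn_lt (PosNum a'0).
exists (k j) => n /xkP /le_lt_trans; apply.
by move: jP; rewrite div1r ltr_pdivlMr// mulrC.
Qed.

(** Preimages are chosen inside Y from time N down to 0; the values after N are mere filler in Y. *)
Lemma backward_orbit_exists Y : (forall n, Y `<=` F n @` Y) ->
  forall N y, Y y -> exists ys, [/\ forall n, Y (ys n), ys N = y &
    forall n, (n < N)%N -> F n (ys n) = ys n.+1].
Proof.
move=> YF; elim=> [|N IHN] y Yy; first by exists (fun=> y); split.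
have [y' Yy' y'y] := YF N y Yy; have [ys [Yys ysN ysP]] := IHN y' Yy'.
exists (fun n => if (n <= N)%N then ys n else y); split=> [n||n].
- by case: ifP.
- by rewrite ltnn.
- rewrite ltnS => nN; rewrite nN; case: ltnP => [/ysP//|Nn].
  by rewrite (_ : n = N) ?ysN//; apply/eqP; rewrite eqn_leq nN.
Qed.

Lemma s_limit_shadowing_limit Y : (forall n, Y `<=` F n @` Y) ->
  s_limit_shadowing_on F Y -> limit_shadowing_on F Y.
Proof.
move=> YF sF xs Yxs /limit_pseudo_orbitP lxs.
(* The precision 1 is arbitrary: only the convergence is kept. *)
have [d d0 dP] := sF 1 ltr01.
have [N NP] := lxs d d0.
have [ys [Yys ysN ysP]] := backward_orbit_exists YF N (Yxs N).
pose zs n := if (n < N)%N then ys n else xs n.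
have zsE n : (N <= n)%N -> zs n = xs n by rewrite /zs ltnNge => ->.
have [n|n|_ [|x [_ /limit_shadowsP xP]]] := dP zs.
- by rewrite /zs; case: ifP.
- have [Nn|nN] := leqP N n; first by rewrite !zsE ?(leqW Nn)//; exact: NP.
  (* At n + 1 = N the pieces agree, since [ys N] is [xs N]. *)
  have -> : zs n.+1 = ys n.+1.
    rewrite /zs; case: ltnP => // Nn.
    by rewrite (_ : n.+1 = N) ?ysN//; apply/eqP; rewrite eqn_leq nN.
  by rewrite /zs nN ysP// mdistxx.
- apply/limit_pseudo_orbitP => e /lxs[M MP]; exists (maxn N M) => n.
  by rewrite geq_max => /andP[Nn Mn]; rewrite !zsE ?(leqW Nn)//; exact: MP.
- exists x; apply/limit_shadowsP => e /xP[M MP]; exists (maxn N M) => n.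
  by rewrite geq_max => /andP[Nn Mn]; rewrite -zsE//; exact: MP.
Qed.

End Shadowing.

Theorem theorem4p2 (R : realType) (X : metricType R) (F : tvmap X) (Y : set X)
    (compactX : compact [set: X]) (closedY : closed Y) :
  ((exists U : set X, [/\ open U, Y `<=` U & h_shadowing_on F U]) ->
     s_limit_shadowing_on F Y /\
     ((forall n, Y `<=` F n @` Y) -> limit_shadowing_on F Y)) /\
  (forall invY : tv_invariant F Y, h_shadowing (restr invY) ->
     s_limit_shadowing (restr invY) /\ limit_shadowing (restr invY)) /\
  (h_shadowing F ->
     s_limit_shadowing F /\
     ((forall n, set_surj [set: X] [set: X] (F n)) -> limit_shadowing F)).
Proof.
split=> [[U [oU YU hU]]|].
  have sY : s_limit_shadowing_on F Y by exact: h_shadowing_s_limit hU.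
  by split=> // YF; exact: s_limit_shadowing_limit.
split=> [invY hY|hX].
  have sY : s_limit_shadowing (restr invY).
    (* The general result is applied in the space [submetric Y], with the whole space as both the
       closed and the open set. *)
    have cY := submetric_compact
      (subclosed_compact closedY compactX (@subsetT _ Y)).
    exact: (h_shadowing_s_limit cY closedT openT (@subsetT _ _) hY).
  split=> //; apply: s_limit_shadowing_limit sY => n y _.
  have : (F n @` Y) (submetric_val y).
    by rewrite invY; exact: submetric_valP.
  case=> x Yx xy; exists (exist (fun x => x \in Y) x (mem_set Yx)) => //.
  exact: val_inj.
have sX : s_limit_shadowing F.
  exact: (h_shadowing_s_limit compactX closedT openT (@subsetT _ _) hX).
by split=> // FX; exact: s_limit_shadowing_limit sX.
Qed.
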